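(* Suppose that $v_j$ is a proper vertex in the cyclically ordered quiver $(Q,\sigma)$. Let $U$ be the unipotent companion of $Q$ with respect to a linear order $<$ associated to $\sigma$ such that $v_j<v_k$ for every $v_k\in \mathrm{Out}(v_j)$. Then the matrix $M_Q(v_j,1)\,U\,M_Q(v_j,1)^T$ is a unipotent companion of $\mu_{v_j}(Q,\sigma)$.
   Context: A quiver is a finite directed graph with parallel edges (arrows) allowed and no oriented cycles of length 1 or 2; all vertices are mutable. Write $u\to v$ if there is at least one arrow from $u$ to $v$; $\mathrm{In}(v)=\{u: u\to v\}$, $\mathrm{Out}(v)=\{u: v\to u\}$. The exchange matrix $B_Q=(b_{uv})$ is the skew-symmetric matrix indexed by vertices with $b_{uv}=\#\{\text{arrows }u\to v\}-\#\{\text{arrows }v\to u\}$. Mutation $\mu_v(Q)$: (1) for each oriented path $u\to v\to w$ add a new arrow $u\to w$ (with multiplicity); (2) reverse all arrows incident to $v$; (3) remove oriented 2-cycles one at a time until none remain. A cyclic ordering $\sigma$ is a linear ordering up to cyclic shifts; the linear orderings in this class are associated to $\sigma$. Moving clockwise means moving in the increasing direction (wrapping around). A cyclically ordered quiver (COQ) $(Q,\sigma)$ is a quiver with a cyclic ordering of its vertices. An oriented path $u\to v\to w$ makes a right turn at $v$ if $u<v<w$ in some linear order associated to $\sigma$; $v$ is proper if every oriented path $u\to v\to w$ makes a right turn at $v$. A wiggle fixes $Q$ and transposes two vertices adjacent in the cyclic ordering and not joined by an arrow of $Q$; wiggle equivalence is the generated equivalence relation. To mutate $(Q,\sigma)$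 at a proper vertex $v$, replace $Q$ by $\mu_v(Q)$ and move $v$ clockwise, from its original position, past all elements of $\mathrm{In}(v)$ (each once) without passing any element of $\mathrm{Out}(v)$, with In and Out computed in the mutated quiver; all choices are wiggle equivalent, and $\mu_v(Q,\sigma)$ denotes the resulting wiggle equivalence class. The unipotent companion of a linearly ordered quiver $(Q,<)$ is the unipotent upper triangular matrix $U$ with $U^T-U=B_Q$, rows and columns written in the order $<$. A unipotent companion of a COQ $(Q,\sigma)$ is the unipotent companion of $(Q,<)$ for some $<$ associated to $\sigma$; a unipotent companion of a wiggle equivalence class is a unipotent companion of some COQ in it. Matrices are regarded as indexed by vertices: a vertex-indexed matrix is called a unipotent companion if it becomes one after simultaneously reordering its rows and columns according to the relevant linear order. For a vertex $v$ and $\varepsilon=\pm1$, $M_Q(v,\varepsilon)=J+E$, where $J$ is diagonal with $J_{vv}=-1$ and $J_{qq}=1$ for $q\ne v$, and $E=(e_{pq})$ has $v$-th column $e_{qv}=\max(0,-\varepsilon b_{qv})$ and all other columns zero. *)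

(* Defs.v *)
(* Vertices of a quiver on n vertices are the elements of 'I_n, so
   that a vertex-indexed matrix is an element of 'M[int]_n. *)
From HB Require Import structures.
From Stdlib Require Import Relation_Operators.
From mathcomp Require Import all_boot all_order all_algebra.
Set Implicit Arguments.
Unset Strict Implicit.
Unset Printing Implicit Defensive.
Import Order.TTheory GRing.Theory Num.Theory.
Local Open Scope ring_scope.

(* [arrows u v] is the number of arrows from u to v. *)
Record quiver (n : nat) := Quiver {
  arrows :> 'M[nat]_n;
  quiver_no_loop : forall u, arrows u u = 0%N;
  quiver_no_2cycle : forall u v, arrows u v = 0%N \/ arrows v u = 0%N }.

Section Quivers.
Variable n : nat.
Implicit Types (Q : quiver n) (a : 'M[nat]_n) (u v w : 'I_n).

Definition has_arrow Q u v : bool := (0 < Q u v)%N.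
Definition In_nbrs Q v : {set 'I_n} := [set u | has_arrow Q u v].
Definition Out_nbrs Q v : {set 'I_n} := [set u | has_arrow Q v u].

Definition exchange_mx Q : 'M[int]_n :=
  \matrix_(u, v) ((Q u v)%:Z - (Q v u)%:Z).

Definition add_paths v a : 'M[nat]_n :=
  \matrix_(u, w) (a u w + a u v * a v w)%N.
Definition reverse_at v a : 'M[nat]_n :=
  \matrix_(u, w) (if (u == v) || (w == v) then a w u else a u w).
(* Truncated subtraction: removing 2-cycles between u and w one at a time
   deletes minn (a u w) (a w u) arrows in each direction. *)
Definition cancel_2cycles a : 'M[nat]_n :=
  \matrix_(u, w) (a u w - a w u)%N.

Definition mutate_arrows v a : 'M[nat]_n :=
  cancel_2cycles (reverse_at v (add_paths v a)).

Lemma mutate_arrows_no_loop v a u : mutate_arrows v a u u = 0%N.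
Proof. by rewrite mxE subnn. Qed.

Lemma mutate_arrows_no_2cycle v a u w :
  mutate_arrows v a u w = 0%N \/ mutate_arrows v a w u = 0%N.
Proof.
rewrite /mutate_arrows; move: (reverse_at _ _) => b; rewrite !mxE.
by case/orP: (leq_total (b u w) (b w u)) => h; [left | right];
  apply/eqP; rewrite subn_eq0.
Qed.

Definition mutate_quiver Q v : quiver n :=
  Quiver (@mutate_arrows_no_loop v Q) (@mutate_arrows_no_2cycle v Q).

End Quivers.

(* A linear order on the vertices, as the list of all vertices in increasing
   order; a duplicate-free n-tuple over 'I_n contains every vertex. *)
Record lin_order (n : nat) := LinOrder {
  lin_tuple :> n.-tuple 'I_n;
  lin_uniq : uniq lin_tuple }.
HB.instance Definition _ n := [isSub for @lin_tuple n].
HB.instance Definition _ n := [Finite of lin_order n by <:].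

Section CyclicOrders.
Variable n : nat.
Implicit Types (l : lin_order n) (u v w : 'I_n).

Definition lin_lt l u v : bool := (index u l < index v l)%N.

Definition cyclic_shifts l : {set lin_order n} :=
  [set l' : lin_order n | [exists k : 'I_n.+1, (l' : seq 'I_n) == rot k l]].

(* A cyclic ordering is a class of linear orders modulo cyclic shifts. *)
Record cyclic_order := CyclicOrder {
  associated : {set lin_order n};
  associated_class : exists l, associated = cyclic_shifts l }.

Record coquiver := COQ {
  coq_quiver : quiver n;
  coq_order : cyclic_order }.
Implicit Types (c : coquiver) (s : cyclic_order).

Definition right_turn s u v w : Prop :=
  exists l, [/\ l \in associated s, lin_lt l u v & lin_lt l v w].

Definition proper_vertex c v : Prop :=
  forall u w, has_arrow (coq_quiver c) u v -> has_arrow (coq_quiver c) v w ->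
  right_turn (coq_order c) u v w.

(* Vertices adjacent in the cyclic ordering come first and second in some
   associated linear order. *)
Definition wiggle c c' : Prop :=
  coq_quiver c' = coq_quiver c /\
  exists (x y : 'I_n) (t : seq 'I_n) (l l' : lin_order n),
    [/\ l \in associated (coq_order c) /\ l' \in associated (coq_order c'),
        l = x :: y :: t :> seq 'I_n,
        l' = y :: x :: t :> seq 'I_n,
        ~~ has_arrow (coq_quiver c) x y & ~~ has_arrow (coq_quiver c) y x].

Definition wiggle_equiv : coquiver -> coquiver -> Prop :=
  clos_refl_sym_trans coquiver wiggle.

(* s' is obtained from s by moving v clockwise past exactly the vertices of A,
   which must include In(v) and avoid Out(v), computed in Q. *)
Definition clockwise_move (Q : quiver n) v s s' : Prop :=
  exists (A B : seq 'I_n) (l l' : lin_order n),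
    [/\ l \in associated s /\ l' \in associated s',
        l = v :: A ++ B :> seq 'I_n,
        l' = A ++ v :: B :> seq 'I_n,
        forall u, u \in In_nbrs Q v -> u \in A
      & forall u, u \in Out_nbrs Q v -> u \notin A].

(* The wiggle equivalence class obtained by mutating c at v; meaningful only
   when v is proper. *)
Definition mutation_class c v : coquiver -> Prop := fun c' =>
  exists s', clockwise_move (mutate_quiver (coq_quiver c) v) v (coq_order c) s'
    /\ wiggle_equiv (COQ (mutate_quiver (coq_quiver c) v) s') c'.

Definition reorder l (X : 'M[int]_n) : 'M[int]_n :=
  mxsub (tnth l) (tnth l) X.

Definition upper_unitriangular (X : 'M[int]_n) : Prop :=
  (forall i, X i i = 1) /\ (forall i j : 'I_n, (j < i)%N -> X i j = 0).

(* Here U is vertex-indexed. *)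
Definition is_companion_lin (Q : quiver n) l (U : 'M[int]_n) : Prop :=
  upper_unitriangular (reorder l U) /\
  (reorder l U)^T - reorder l U = reorder l (exchange_mx Q).

Definition is_companion_coq c (U : 'M[int]_n) : Prop :=
  exists2 l, l \in associated (coq_order c) &
    is_companion_lin (coq_quiver c) l U.

Definition is_companion_class (C : coquiver -> Prop) (U : 'M[int]_n) : Prop :=
  exists2 c, C c & is_companion_coq c U.

Definition J_mx v : 'M[int]_n :=
  \matrix_(p, q) (if p == q then (if p == v then -1 else 1) else 0).

Definition E_mx (Q : quiver n) v (eps : int) : 'M[int]_n :=
  \matrix_(p, q) (if q == v then Num.max 0 (- eps * exchange_mx Q p v) else 0).

(* Used for eps = 1 or -1. *)
Definition M_mx (Q : quiver n) v (eps : int) : 'M[int]_n :=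
  J_mx v + E_mx Q v eps.

End CyclicOrders.

(* Main.v *)
Require Import Defs.
From Stdlib Require Import Relation_Operators.
From mathcomp Require Import all_boot all_order all_algebra.
From mathcomp Require Import zify ring.
Import GRing.Theory.
Local Open Scope ring_scope.
Set Implicit Arguments.
Unset Strict Implicit.
Unset Printing Implicit Defensive.

(** Write [M] for [M_mx Q v 1].  Off the [v]-th row, [M *m X] adds to row [p]
    of [X] the row [v] taken [Q v p] times, and it negates row [v].  Two facts
    about the congruence [X |-> M *m X *m M^T] give the result.

    Skew part.  It sends the exchange matrix of [Q] to that of the mutated
    quiver ([M_congr_exchange]).  Since [U^T - U] is the exchange matrix of
    [Q], the congruent matrix has the right skew part whatever the order on
    the vertices: only unitriangularity depends on the order.

    Order.  In [l], the in-neighbours of [v] above [v] lie above all its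
    out-neighbours, because [v] is proper and the out-neighbours lie above
    [v].  Cutting the part of [l] above [v] just before its first
    in-neighbour thus writes [l] as [L ++ v :: A ++ B], where [A] contains
    every out-neighbour and no in-neighbour ([proper_split]).  Mutation
    exchanges in- and out-neighbours, so [L ++ A ++ v :: B] is, up to a cyclic
    shift, a legal clockwise move of [v] past [A].

    Unitriangularity in the new order ([M_congr_companion]).  The entry
    [(p, q)], for [p] and [q] other than [v], changes by
    [Q v p * (U v q + Q v q) + Q v q * U p v], and [U v q + Q v q] is [Q q v]
    when [q] is above [v].  Below the diagonal the last term is zero, since an
    out-neighbour [q] below [p] puts [p] above [v]; so a nonzero change would
    need [p] in [A] and an in-neighbour [q] of [v] between [v] and [p], hence
    in [A] too, which is excluded.  The only entries that the move of [v]
    brings below the diagonal are the [(v, q)] with [q] in [A]; the new entry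
    there is [- (U v q + Q v q) = - Q q v = 0]. *)

(** * Linear orders and their cyclic shifts *)

Section Orders.
Variable n : nat.
Implicit Types (l : lin_order n) (s t : seq 'I_n) (x y v : 'I_n).

Lemma mem_lin l x : x \in (l : seq 'I_n).
Proof.
have /subset_cardP : #|(l : seq 'I_n)| = #|'I_n|.
  by rewrite (card_uniqP (lin_uniq l)) size_tuple card_ord.
by move=> /(_ (subset_predT _)) ->.
Qed.

Lemma lin_index_lt l x : (index x l < n)%N.
Proof. by have := mem_lin l x; rewrite -index_mem size_tuple. Qed.

Lemma lin_order_of_perm l (s : seq 'I_n) :
  perm_eq s l -> exists l' : lin_order n, l' = s :> seq 'I_n.
Proof.
move=> eq_sl.
have sz : size s == n by rewrite (perm_size eq_sl) size_tuple.
have us : uniq (Tuple sz) by rewrite /= (perm_uniq eq_sl) lin_uniq.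
by exists (LinOrder us).
Qed.

Lemma lin_lt_total l x y : x != y -> lin_lt l x y || lin_lt l y x.
Proof.
rewrite /lin_lt -neq_ltn; apply: contra_neq => eq_xy.
by rewrite -(nth_index y (mem_lin l x)) eq_xy nth_index ?mem_lin.
Qed.

Lemma lin_lt_antisym l x y : lin_lt l x y -> ~~ lin_lt l y x.
Proof. by rewrite /lin_lt -leqNgt => /ltnW. Qed.

Lemma lin_lt_cat l s1 s2 x y :
  l = s1 ++ s2 :> seq 'I_n -> x \in s1 -> y \in s2 -> lin_lt l x y.
Proof.
move=> def_l xs1 ys2; have := lin_uniq l.
rewrite def_l cat_uniq => /and3P[_ /hasPn/(_ y ys2)/= ys1 _].
rewrite /lin_lt def_l !index_cat xs1 (negPf ys1).
by rewrite (leq_trans _ (leq_addr _ _)) // index_mem.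
Qed.

Lemma lin_lt_split l s1 s2 x y : l = s1 ++ x :: s2 :> seq 'I_n ->
  lin_lt l y x = (y \in s1) /\ lin_lt l x y = (y \in s2).
Proof.
move=> def_l; have xx : ~~ lin_lt l x x by rewrite /lin_lt ltnn.
have [y1|y1] := boolP (y \in s1).
  have lt_yx : lin_lt l y x by rewrite (lin_lt_cat def_l) ?mem_head.
  rewrite lt_yx (negPf (lin_lt_antisym lt_yx)); split=> //.
  have := lin_uniq l; rewrite def_l cat_uniq => /and3P[_ /hasPn dis _].
  by apply/esym/negbTE; apply: contraL y1 => y2; apply: dis; rewrite inE y2 orbT.
have := mem_lin l y; rewrite def_l mem_cat (negPf y1) inE /=.
case: eqVneq => [-> _|ne_yx /= y2].
  rewrite (negPf xx); split=> //; have := lin_uniq l.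
  by rewrite def_l cat_uniq /= => /and4P[_ _ /negPf-> _].
have lt_xy : lin_lt l x y.
  by apply: (@lin_lt_cat l (rcons s1 x) s2); rewrite ?cat_rcons ?mem_rcons ?mem_head.
by rewrite lt_xy y2 (negPf (lin_lt_antisym lt_xy)).
Qed.

Lemma index_delete (s1 s2 : seq 'I_n) x y :
  x != y -> index y (s1 ++ x :: s2) = bump (size s1) (index y (s1 ++ s2)).
Proof.
move=> /negPf ne_xy; rewrite !index_cat /= ne_xy /bump.
case: ifP => [|_]; first by rewrite -index_mem [(size s1 <= _)%N]leqNgt => ->.
by rewrite leq_addr add1n addnS.
Qed.

Lemma lin_lt_move l l' s1 s2 t1 t2 v x y :
  l = s1 ++ v :: s2 :> seq 'I_n -> l' = t1 ++ v :: t2 :> seq 'I_n ->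
  s1 ++ s2 = t1 ++ t2 -> v != x -> v != y -> lin_lt l x y = lin_lt l' x y.
Proof.
move=> def_l def_l' eq_st ne_vx ne_vy; rewrite /lin_lt def_l def_l'.
by rewrite !index_delete // eq_st /bump; lia.
Qed.

Lemma rot_in_shifts l l' k : l' = rot k l :> seq 'I_n -> l' \in cyclic_shifts l.
Proof.
move=> def_l'; rewrite inE; apply/existsP.
have lt_m : (minn k n < n.+1)%N by rewrite ltnS geq_minr.
by exists (Ordinal lt_m); rewrite def_l' /= rot_minn size_tuple.
Qed.

Lemma shifts_rot l0 l l' :
  l \in cyclic_shifts l0 -> l' \in cyclic_shifts l0 ->
  exists2 m, (m <= n)%N & l' = rot m l :> seq 'I_n.
Proof.
rewrite !inE => /existsP[k /eqP def_l] /existsP[k' /eqP def_l'].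
have def_l0 : l0 = rot (n - k) l :> seq 'I_n.
  by rewrite -[LHS](rotK k) -def_l /rotr size_tuple.
rewrite def_l0 rot_add_mod ?size_tuple ?leq_subr -1?ltnS // in def_l'.
move: def_l'; case: ifP => [le_m|_] ->.
  by exists (k' + (n - k))%N; rewrite // addnC.
by exists (k' + (n - k) - n)%N => //; have := ltn_ord k'; lia.
Qed.

Lemma shifts_trans l0 l l' m :
  l \in cyclic_shifts l0 -> l' = rot m l :> seq 'I_n -> l' \in cyclic_shifts l0.
Proof.
move=> l_in def_l'.
have l0_in : l0 \in cyclic_shifts l0 by apply: (@rot_in_shifts _ _ 0); rewrite rot0.
have [k le_k def_l0] := shifts_rot l0_in l_in.
rewrite def_l0 rot_minn in def_l'.
rewrite rot_add_mod ?size_rot ?size_tuple ?geq_minr // in def_l'.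
by move: def_l'; case: ifP => _ /rot_in_shifts.
Qed.

(** Rotating by [m] shifts the first [m] positions up by [n - m] and the
    others down by [m]; on indices, cyclic statements become arithmetic. *)
Lemma index_rot l m x : (m <= n)%N ->
  index x (rot m l)
  = if (index x l < m)%N then (index x l + (n - m))%N else (index x l - m)%N.
Proof.
move=> le_m; have st : size (take m l) = m by rewrite size_takel ?size_tuple.
have sd : size (drop m l) = (n - m)%N by rewrite size_drop size_tuple.
have := mem_lin l x; have := lin_uniq l; rewrite /rot.
move: (take m l) (drop m l) (cat_take_drop m l) st sd => s1 s2 <- sz1 sz2.
rewrite cat_uniq mem_cat => /and3P[_ /hasPn dis _].
have [x1 _|x1 /= x2] := boolP (x \in s1); rewrite !index_cat.
  have /negPf-> : x \notin s2 by apply: contraL x1 => /dis.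
  by have lt_m := x1; rewrite -index_mem sz1 in lt_m; rewrite x1 lt_m sz2; lia.
by rewrite (negPf x1) x2 sz1 -{2}[m]addn0 ltn_add2l ltn0 addKn.
Qed.

(** A rotation reverses the order of two elements only when it separates them,
    so it cannot turn [v < u < w] into [u < v < w]: putting [u] before [v]
    also puts [w] before [v]. *)
Lemma right_turn_lin (sigma : cyclic_order n) l (u v w : 'I_n) :
  l \in associated sigma -> right_turn sigma u v w ->
  lin_lt l v u -> lin_lt l u w -> False.
Proof.
have [l0 def_sigma] := associated_class sigma.
rewrite /right_turn def_sigma => l_in [l' [l'_in]].
have [m le_m def_l'] := shifts_rot l_in l'_in.
rewrite /lin_lt def_l' !index_rot //.
have := lin_index_lt l u; have := lin_index_lt l v; have := lin_index_lt l w.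
by do !case: ifP; lia.
Qed.

End Orders.

(** * Unipotent companions as vertex-indexed matrices *)

(** Restating the definition without reordering the matrix lets the skew
    condition drop its reference to the order. *)
Lemma companion_linP n (Q : quiver n) (l : lin_order n) (X : 'M[int]_n) :
  is_companion_lin Q l X <->
  [/\ forall u, X u u = 1, forall p q, lin_lt l q p -> X p q = 0
    & X^T - X = exchange_mx Q].
Proof.
have tnth_index x : exists2 i : 'I_n, tnth l i = x & index x l = i.
  exists (Ordinal (lin_index_lt l x)) => //.
  by rewrite (tnth_nth x) /= nth_index ?mem_lin.
have index_tnth (i : 'I_n) : index (tnth l i) l = i.
  by rewrite (tnth_nth (tnth l i)) index_uniq ?size_tuple ?lin_uniq.
split=> [[[diag tri] skew]|[diag tri skew]].
  split.
  - by move=> u; have [i <- _] := tnth_index u; have := diag i; rewrite mxE.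
  - move=> p q; have [i <- _] := tnth_index p; have [j <- _] := tnth_index q.
    by rewrite /lin_lt !index_tnth => /tri; rewrite mxE.
  - apply/matrixP=> p q; have [i <- _] := tnth_index p.
    have [j <- _] := tnth_index q.
    by have /matrixP/(_ i j) := skew; rewrite !mxE.
split; first split.
- by move=> i; rewrite mxE.
- by move=> i j lt_ji; rewrite mxE tri // /lin_lt !index_tnth.
- by rewrite -skew; apply/matrixP=> i j; rewrite !mxE.
Qed.

(** * Congruence by the mutation matrix *)

Section Congruence.
Variables (n : nat) (Q : quiver n) (v : 'I_n).

Lemma has_arrowPn u w : ~~ has_arrow Q u w -> Q u w = 0%N.
Proof. by rewrite /has_arrow -eqn0Ngt => /eqP. Qed.

Let sgn (p : 'I_n) : int := if p == v then -1 else 1.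

Lemma M_mxE p q :
  M_mx Q v 1 p q = (if q == p then sgn p else 0)
                   + (if q == v then (Q v p)%:Z else 0).
Proof.
rewrite !mxE eq_sym; congr (_ + _); case: eqP => // _.
by have [->|->] := quiver_no_2cycle Q p v; lia.
Qed.

Lemma M_mulmxE (X : 'M[int]_n) p q :
  (M_mx Q v 1 *m X) p q = sgn p * X p q + (Q v p)%:Z * X v q.
Proof.
rewrite mxE (eq_bigr (fun r => (if r == p then sgn p * X p q else 0)
  + (if r == v then (Q v p)%:Z * X v q else 0))); last first.
  move=> r _; rewrite M_mxE mulrDl.
  by congr (_ + _); case: eqP => [->|_]; rewrite ?mul0r.
by rewrite big_split -!big_mkcond !big_pred1_eq.
Qed.

Lemma M_congrE (X : 'M[int]_n) p q :
  (M_mx Q v 1 *m X *m (M_mx Q v 1)^T) p q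
  = sgn q * (sgn p * X p q + (Q v p)%:Z * X v q)
    + (Q v q)%:Z * (sgn p * X p v + (Q v p)%:Z * X v v).
Proof.
rewrite -[_ *m _^T]trmxK mxE trmx_mul trmxK M_mulmxE.
by rewrite ![(_ *m X)^T _ _]mxE !M_mulmxE.
Qed.

(** For [p] and [q] other than [v], the entry [b_pq] becomes
    [b_pq + Q p v * Q v q - Q v p * Q q v], because [b_vv = 0] and the terms
    [Q v p * Q v q] come with opposite signs; this counts the arrows created by
    the paths through [v], 2-cycles being invisible to [b]. *)
Lemma M_congr_exchange :
  M_mx Q v 1 *m exchange_mx Q *m (M_mx Q v 1)^T
  = exchange_mx (mutate_quiver Q v).
Proof.
apply/matrixP=> p q; rewrite M_congrE !mxE /sgn.
have subz (a b : nat) : (a - b)%N%:Z - (b - a)%N%:Z = a%:Z - b%:Z :> int by lia.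
rewrite subz !(quiver_no_loop Q v).
case: (eqVneq p v) => [->|_]; case: (eqVneq q v) => [->|_] /=;
  rewrite ?(quiver_no_loop Q v) ?muln0 ?mul0n ?addn0 ?PoszD ?PoszM; ring.
Qed.

(** The hypotheses on [A] are all that the matrix computation needs from the
    properness of [v]: no in-neighbour of [v] lies between [v] and one of its
    out-neighbours, and [v] jumps over [A] in one piece. *)
Lemma M_congr_companion (l l' : lin_order n) (L A B : seq 'I_n)
    (U : 'M[int]_n) :
    l = L ++ v :: A ++ B :> seq 'I_n -> l' = L ++ A ++ v :: B :> seq 'I_n ->
    {in A, forall u, ~~ has_arrow Q u v} ->
    (forall w, has_arrow Q v w -> w \in A) ->
    is_companion_lin Q l U ->
  is_companion_lin (mutate_quiver Q v) l'
    (M_mx Q v 1 *m U *m (M_mx Q v 1)^T).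
Proof.
move=> def_l def_l' A_not_in out_A /companion_linP[diag tri skew].
have before x := (lin_lt_split x def_l).1.
have after x := (lin_lt_split x def_l).2.
have out_after w : has_arrow Q v w -> lin_lt l v w.
  by move=> /out_A wA; rewrite after mem_cat wA.
have no_out w : lin_lt l w v -> Q v w = 0%N.
  move=> /lin_lt_antisym nlt_vw; apply: has_arrowPn.
  by apply: contra nlt_vw => /out_after.
have Uv q : lin_lt l v q -> U v q + (Q v q)%:Z = (Q q v)%:Z.
  move=> lt_vq; have /matrixP/(_ v q) := skew.
  by rewrite !mxE (tri q v lt_vq) sub0r => /(canRL (@opprK _)) ->; ring.
apply/companion_linP; split.
(* On the diagonal, the added terms are [Q v p * (U v p + U p v + Q v p)];
   if [p] is an out-neighbour, it lies above [v], so [U p v] is zero and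
   [U v p] is [- Q v p]. *)
- move=> p; rewrite M_congrE /sgn.
  case: (eqVneq p v) => [->|ne_pv]; first by rewrite diag (quiver_no_loop Q v).
  rewrite !diag; have /orP[lt_pv|lt_vp] := lin_lt_total l ne_pv.
    by rewrite no_out //; ring.
  have := Uv p lt_vp; rewrite (tri p v lt_vp).
  have [->|->] := quiver_no_2cycle Q v p; first by move=> _; ring.
  by move=> /eqP; rewrite addr_eq0 => /eqP->; ring.
- rewrite catA in def_l'.
  move=> p q lt_qp; rewrite M_congrE /sgn.
  case: (eqVneq p v) => [def_p|ne_pv]; case: (eqVneq q v) => [def_q|ne_qv].
  + by move: lt_qp; rewrite def_p def_q /lin_lt ltnn.
  + move: lt_qp; rewrite def_p (quiver_no_loop Q v) diag.
    rewrite (lin_lt_split q def_l').1 mem_cat -before => /orP[lt_qv|qA].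
      by rewrite tri // no_out //; ring.
    have lt_vq : lin_lt l v q by rewrite after mem_cat qA.
    have := Uv q lt_vq; rewrite (has_arrowPn (A_not_in q qA)) => /eqP.
    by rewrite addr_eq0 => /eqP->; ring.
  + move: lt_qp; rewrite def_q (quiver_no_loop Q v).
    rewrite (lin_lt_split p def_l').2 => pB.
    rewrite tri; last by rewrite after mem_cat pB orbT.
    have -> : Q v p = 0%N; last by ring.
    apply: has_arrowPn; apply/negP=> /out_A pA.
    have := lin_uniq l'; rewrite def_l' cat_uniq => /and3P[_ /hasPn/(_ p)].
    by rewrite inE pB orbT mem_cat pA orbT => /(_ isT).
  rewrite -(lin_lt_move def_l def_l') 1?eq_sym // ?catA // in lt_qp.
  have [out_p|/has_arrowPn out_p] := boolP (has_arrow Q v p); last first.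
    rewrite out_p tri // !mul0r !mulr0 !addr0 add0r mul1r.
    have [/out_after lt_vq|/has_arrowPn ->] := boolP (has_arrow Q v q).
      rewrite (tri p v) ?mulr0 //.
      by move: lt_qp lt_vq; rewrite /lin_lt; lia.
    by rewrite mul0r.
  rewrite (tri p q) // (tri p v) ?out_after // diag.
  have /orP[lt_qv|lt_vq] := lin_lt_total l ne_qv.
    by rewrite tri // (no_out q) //; ring.
  have qA : q \in A.
    move: lt_vq; rewrite after mem_cat => /orP[//|qB].
    have := lin_lt_antisym lt_qp; rewrite (@lin_lt_cat n l (L ++ v :: A) B) //.
      by rewrite def_l -catA.
    by rewrite mem_cat inE out_A ?orbT.
  have := Uv q lt_vq; rewrite (has_arrowPn (A_not_in q qA)) => /eqP.
  by rewrite addr_eq0 => /eqP->; ring.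
- rewrite -M_congr_exchange -skew mulmxBr mulmxBl; congr (_ - _).
  by rewrite trmx_mul trmxK trmx_mul mulmxA.
Qed.

End Congruence.

(** * The move of the mutated vertex *)

Section Mutate.
Variables (n : nat) (Q : quiver n) (v : 'I_n).

Lemma mutate_arrow_from u : has_arrow (mutate_quiver Q v) u v = has_arrow Q v u.
Proof.
rewrite /has_arrow !mxE eqxx orbT /= (quiver_no_loop Q v) muln0 mul0n !addn0.
by have [->|->] := quiver_no_2cycle Q v u; lia.
Qed.

Lemma mutate_arrow_to u : has_arrow (mutate_quiver Q v) v u = has_arrow Q u v.
Proof.
rewrite /has_arrow !mxE eqxx orbT /= (quiver_no_loop Q v) muln0 mul0n !addn0.
by have [->|->] := quiver_no_2cycle Q v u; lia.
Qed.

End Mutate.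

(** [A] is the longest initial segment of the part of [l] above [v] that avoids
    the in-neighbours of [v].  An out-neighbour [w] left over in [B] would lie
    above the in-neighbour [u] heading [B], and [v < u < w] contradicts the
    right turn at [v] of the path [u -> v -> w]. *)
Lemma proper_split (n : nat) (Q : quiver n) (sigma : cyclic_order n) (v : 'I_n)
    (l : lin_order n) :
    proper_vertex (COQ Q sigma) v -> l \in associated sigma ->
    (forall w, has_arrow Q v w -> lin_lt l v w) ->
  exists L A B, [/\ l = L ++ v :: A ++ B :> seq 'I_n,
    {in A, forall u, ~~ has_arrow Q u v} & forall w, has_arrow Q v w -> w \in A].
Proof.
move=> proper_v l_in out_after.
have [L [R def_l]] : exists L R, l = L ++ v :: R :> seq 'I_n.
  by case/splitPr: (mem_lin l v) => L R; exists L, R.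
have [A [B [def_R A_not_in B_in]]] : exists A B, [/\ R = A ++ B,
    {in A, forall u, ~~ has_arrow Q u v}
    & forall u B', B = u :: B' -> has_arrow Q u v].
  elim: R {def_l} => [|u R [A [B [-> A_not_in B_in]]]]; first by exists [::], [::].
  have [in_u|not_in_u] := boolP (has_arrow Q u v).
    by exists [::], (u :: A ++ B); split=> // _ _ [<- _].
  exists (u :: A), B; split=> // x; rewrite inE => /orP[/eqP-> //|].
  exact: A_not_in.
exists L, A, B; split=> //; first by rewrite def_l def_R.
move=> w out_w; have lt_vw := out_after w out_w.
have := lt_vw; rewrite (lin_lt_split w def_l).2 def_R mem_cat => /orP[//|].
case: B => [//|u B] in def_R B_in *; have in_u := B_in u B erefl.
have lt_vu : lin_lt l v u.
  by rewrite (lin_lt_split u def_l).2 def_R mem_cat mem_head orbT.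
rewrite inE => /orP[/eqP def_w|wB].
  by case: (quiver_no_2cycle Q u v) in_u out_w; rewrite /has_arrow def_w => ->.
case: (right_turn_lin l_in (proper_v u w in_u out_w) lt_vu).
have def_l' : l = (L ++ v :: A) ++ u :: B :> seq 'I_n.
  by rewrite def_l def_R -catA.
by rewrite (lin_lt_split w def_l').2.
Qed.

Theorem lemma4p2 (n : nat) (Q : quiver n) (sigma : cyclic_order n) (v : 'I_n)
    (hv : proper_vertex (COQ Q sigma) v)
    (l : lin_order n) (hl : l \in associated sigma)
    (hout : forall w, w \in Out_nbrs Q v -> lin_lt l v w)
    (U : 'M[int]_n) (hU : is_companion_lin Q l U) :
  is_companion_class (mutation_class (COQ Q sigma) v)
    (M_mx Q v 1 *m U *m (M_mx Q v 1)^T).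
Proof.
have out_after w : has_arrow Q v w -> lin_lt l v w.
  by move=> out_w; apply: hout; rewrite inE.
have [L [A [B [def_l A_not_in out_A]]]] := proper_split hv hl out_after.
have [l' def_l'] : exists l' : lin_order n, l' = L ++ A ++ v :: B :> seq 'I_n.
  apply: (@lin_order_of_perm _ l); rewrite def_l perm_cat2l.
  by rewrite -cat1s perm_catCA.
(* A clockwise move is described in linear orders where [v] initially comes
   first, so [L] is wrapped around to the end of both orders. *)
have [m def_m] : exists m : lin_order n, m = v :: A ++ (B ++ L) :> seq 'I_n.
  by apply: (@lin_order_of_perm _ l); rewrite def_l perm_sym perm_catC /= catA.
have [m' def_m'] : exists m' : lin_order n, m' = A ++ v :: (B ++ L) :> seq 'I_n.
  by apply: (@lin_order_of_perm _ l'); rewrite def_l' perm_sym perm_catC -catA.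
have cl : exists l0, cyclic_shifts l' = cyclic_shifts l0 by exists l'.
exists (COQ (mutate_quiver Q v) (CyclicOrder cl)); last first.
  exists l'; first by apply: (@rot_in_shifts _ _ _ 0); rewrite rot0.
  exact: M_congr_companion def_l def_l' A_not_in out_A hU.
exists (CyclicOrder cl); split; last exact: rst_refl.
exists A, (B ++ L), m, m'; split=> //=.
- have [l0 def_s] := associated_class sigma; rewrite def_s in hl *; split.
    apply: (shifts_trans (m := size L) hl).
    by rewrite def_l rot_size_cat def_m /= catA.
  apply: (@rot_in_shifts _ _ _ (size L)).
  by rewrite def_l' rot_size_cat def_m' -catA.
- by move=> u; rewrite inE mutate_arrow_from => /out_A.
- by move=> u; rewrite inE mutate_arrow_to; apply: contraL => /A_not_in.
Qed.
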